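(* Suppose that the Integrability assumption holds. In the Markovian dynamic environment, suppose the agent obtains no gain from untruthful reporting by using any one-shot deviation strategy at any $t\in\mathbb{T}$ after any history of truthful reports, i.e., for all $\theta_t,\hat\theta_t\in\Theta_t$ and all truthful report histories $h^\theta_{t-1}\in\prod_{s=1}^{t-1}\Theta_s$: (i) for $t\in\mathbb{T}\setminus\{T\}$, $$\max\Big(J_{1,t}(t,\theta_t|h^\theta_{t-1}),\ \mathbb{E}^{\alpha|\theta_t}\big[V_{t+1}(\tilde\theta_{t+1})\big]\Big)\ \ge\ \max\Big(J_{1,t}(t,\theta_t,\hat\theta_t|h^\theta_{t-1}),\ \mathbb{E}^{\alpha|\theta_t,\hat\theta_t}\big[V_{t+1}(\tilde\theta_{t+1})\big]\Big);$$ (ii) for $t=T$, $\ J_{1,T}(T,\theta_T|h^\theta_{T-1})\ge J_{1,T}(T,\theta_T,\hat\theta_T|h^\theta_{T-1})$. Then the agent obtains no gain by using any untruthful reporting strategy for any arbitrary report history $h^{\hat\theta}_{t-1}\in\prod_{s=1}^{t-1}\Theta_s$; that is, for every reporting strategy $\sigma$, every $\theta_t\in\Theta_t$, and every such history, $$\max\Big(J_{1,t}(t,\theta_t|h^\theta_{t-1}),\ \mathbb{E}^{\Xi_\alpha[h^\theta_t]}\big[V_{t+1}(\tilde\theta_{t+1})\big]\Big)\ge\max\Big(J_{1,t}(t,\theta_t,\sigma_t(\theta_t);\sigma|h^\theta_{t-1}),\ \mathbb{E}^{\Xi_{\alpha;\sigma}[h^\theta_t]}\big[V_{t+1}(\tilde\theta_{t+1};\sigma)\big]\Big)\quad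 (t<T),$$ $$J_{1,T}(T,\theta_T|h^\theta_{T-1})\ge J_{1,T}(T,\theta_T,\sigma_T(\theta_T);\sigma|h^\theta_{T-1}).$$
   Context: Model. $\mathbb{T}=\{1,\dots,T\}$, $T<\infty$, $\mathbb{T}_t=\{t,\dots,T\}$. In period $t$ an agent privately observes a state $\theta_t\in\Theta_t=[\underline\theta_t,\bar\theta_t]\subset\mathbb{R}$ and sends a report $\hat\theta_t\in\Theta_t$ to a principal. $A_t$ is a measurable space of allocations. $h^x_{s,t}=(x_s,\dots,x_t)$, $h^x_t=h^x_{1,t}$. A mechanism $\{\alpha,\phi,\xi,\rho\}$ consists of allocation rules $\alpha_t:\prod_{s\le t}\Theta_s\to A_t$, payment rules $\phi_t,\xi_t:\prod_{s\le t}\Theta_s\to\mathbb{R}$ and $\rho:\mathbb{T}\to\mathbb{R}$ with $\rho(T)=0$; one writes $\alpha_t(\hat\theta_t|h^{\hat\theta}_{t-1})$ etc. In period $t$ the allocation is $\alpha_t(\hat\theta_t|h^{\hat\theta}_{t-1})$; the agent receives payment $\phi_t(\hat\theta_t|h^{\hat\theta}_{t-1})$ if he continues and $\xi_t(\hat\theta_t|h^{\hat\theta}_{t-1})+\rho(t)$ if he stops at $t$. The agent's utility $u_{1,t}:\Theta_t\times A_t\to\mathbb{R}$ is, given any allocation rule, Lipschitz continuous in $\theta_t$; $\delta\in(0,1]$ is the discount factor. Markovian dynamics: $\tilde\theta_1$ has c.d.f. $F_1$ and density $f_1$; given $\theta_{t-1}$ and past allocations $h^a_{t-1}$, $\tilde\theta_t$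 has c.d.f. $F_t(\cdot|\theta_{t-1},h^a_{t-1})$ and density $f_t(\cdot|\theta_{t-1},h^a_{t-1})$, independently of earlier states. A reporting strategy $\sigma$ is a family of maps $\sigma_t(\theta_t|h^{\hat\theta}_{t-1},h^a_{t-1})\in\Theta_t$ (past reports and allocations; past true states are irrelevant). $\Xi_{\alpha;\sigma}$ is the law of the state process under $\alpha,\sigma$, and $\Xi_{\alpha;\sigma}[h^\theta_t]$ is this process given the realized true states $h^\theta_t$ (and the past reports and allocations); $\sigma$ is omitted when the reports (from $t$ on) are truthful. Interim payoffs: for $\tau\in\mathbb{T}_t$, with $\hat\theta_s=\sigma_s(\tilde\theta_s|h^{\hat\theta}_{s-1},h^{a}_{s-1})$ the reports sent, $$J_{1,t}(\tau,\theta_t,\sigma_t(\theta_t);\sigma|h^\theta_{t-1})=\mathbb{E}^{\Xi_{\alpha;\sigma}[h^\theta_t]}\Big[\delta^\tau\big(u_{1,\tau}(\tilde\theta_\tau,\alpha_\tau(\hat\theta_\tau|h^{\hat\theta}_{\tau-1}))+\xi_\tau(\hat\theta_\tau|h^{\hat\theta}_{\tau-1})\big)+\sum_{s=1}^{\tau-1}\delta^s\big(u_{1,s}(\tilde\theta_s,\alpha_s(\hat\theta_s|h^{\hat\theta}_{s-1}))+\phi_s(\hat\theta_s|h^{\hat\theta}_{s-1})\big)\Big]+\rho(\tau),$$ written $J_{1,t}(\tau,\theta_t|h^\theta_{t-1})$ for truthful $\sigma$. Valuations: $V_t(\theta_t;\sigma)=\sup_{\tau\in\mathbb{T}_t}J_{1,t}(\tau,\theta_t,\sigma_t(\theta_t);\sigma|h^\theta_{t-1})$,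 the supremum over time horizons (stopping times) of the process from $t$, given by the Bellman recursion $V_T(\theta_T;\sigma)=J_{1,T}(T,\theta_T,\sigma_T(\theta_T);\sigma|h^\theta_{T-1})$, $V_t(\theta_t;\sigma)=\max\big(J_{1,t}(t,\theta_t,\sigma_t(\theta_t);\sigma|h^\theta_{t-1}),\mathbb{E}^{\Xi_{\alpha;\sigma}[h^\theta_t]}[V_{t+1}(\tilde\theta_{t+1};\sigma)]\big)$; $V_t(\theta_t)$ for truthful $\sigma$. One-shot deviation strategy at $t$: a reporting strategy $\hat\sigma[t]$ that is truthful in every period except $t$, where it reports $\hat\theta_t$ when the state is $\theta_t$. $\mathbb{E}^{\alpha|\theta_t,\hat\theta_t}$ is expectation under $\Xi_{\alpha;\hat\sigma[t]}[h^\theta_t]$, $\mathbb{E}^{\alpha|\theta_t}=\mathbb{E}^{\alpha|\theta_t,\theta_t}$, and $J_{1,t}(\tau,\theta_t,\hat\theta_t|h^\theta_{t-1})$ is the interim payoff under $\hat\sigma[t]$. Integrability: for every reporting strategy $\sigma$ and $t\in\mathbb{T}$, $\mathbb{E}^{\Xi_{\alpha;\sigma}}[\sup_{\tau\in\mathbb{T}_t}|J_{1,t}(\tau,\tilde\theta_t,\sigma_t(\tilde\theta_t);\sigma|h^{\tilde\theta}_{t-1})|]<\infty$. *)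

(* Defs.v *)
From HB Require Import structures.
From mathcomp Require Import all_boot all_order all_algebra.
From mathcomp Require Import all_classical all_reals all_analysis.
From mathcomp Require Import measurable_realfun.

Set Implicit Arguments.
Unset Strict Implicit.
Unset Printing Implicit Defensive.
Import Order.TTheory GRing.Theory Num.Theory.
Import numFieldNormedType.Exports.

Local Open Scope classical_set_scope.
Local Open Scope ring_scope.
Local Open Scope ereal_scope.

Record segment (R : realType) := Segment {
  seg_lo : R;
  seg_hi : R;
  seg_le : (seg_lo <= seg_hi)%R }.

Section state.
Context {R : realType} (I : segment R).

Definition state := {x : R | (seg_lo I <= x <= seg_hi I)%R}.

HB.instance Definition _ := Choice.on state.
HB.instance Definition _ := [isSub of state for @sval R _].

Lemma state_lo : (seg_lo I <= seg_lo I <= seg_hi I)%R.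
Proof. by rewrite lexx seg_le. Qed.

HB.instance Definition _ := isPointed.Build state (exist _ (seg_lo I) state_lo).

Definition state_val (x : state) : measurableTypeR R := sval x.

HB.instance Definition _ := Measurable.copy state
  (g_sigma_algebra_preimageType state_val).

End state.

(* [hist X t] is the product of X 1, ..., X t (there is no period 0), nested to
   the left: h_{t+1} is the pair (h_t, x_{t+1}). *)
Section hist.
Context {d : nat -> measure_display} (X : forall t, measurableType (d t)).

Fixpoint hist_pack t : {d' : measure_display & measurableType d'} :=
  match t with
  | 0 => existT (fun d' => measurableType d') _ unit
  | t'.+1 => existT (fun d' => measurableType d') _
               (projT2 (hist_pack t') * X t'.+1)%type
  end.

Definition hist t : measurableType (projT1 (hist_pack t)) :=
  projT2 (hist_pack t).

Definition hrcons t (h : hist t) (x : X t.+1) : hist t.+1 := (h, x).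

End hist.

Section kernels.
Context d1 d2 d3 (X : measurableType d1) (Y : measurableType d2)
  (Z : measurableType d3) (R : realType).

Section kpre.
Variables (k : R.-pker Y ~> Z) (f : {mfun X >-> Y}).

Definition kpre : X -> {measure set Z -> \bar R} := fun x => k (f x).

Lemma measurable_kpre U : measurable U -> measurable_fun [set: X] (kpre ^~ U).
Proof.
move=> mU; have mk := measurable_kernel k U mU.
exact: (measurableT_comp mk (measurable_funPT f)).
Qed.

HB.instance Definition _ := isKernel.Build _ _ _ _ _ kpre measurable_kpre.

Lemma kpre_prob x : kpre x [set: Z] = 1.
Proof. exact: prob_kernel. Qed.

HB.instance Definition _ := Kernel_isProbability.Build _ _ _ _ _ kpre kpre_prob.
End kpre.

(* [mkproduct] as a probability kernel, so that it can be iterated *)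
Section kchain.
Variables (k1 : R.-pker X ~> Y) (k2 : R.-pker (X * Y) ~> Z).

Definition kchain : X -> {measure set (Y * Z) -> \bar R} := mkproduct k1 k2.

Lemma measurable_kchain U : measurable U -> measurable_fun [set: X] (kchain ^~ U).
Proof. exact: measurable_kproduct. Qed.

HB.instance Definition _ := isKernel.Build _ _ _ _ _ kchain measurable_kchain.

Lemma kchain_prob x : kchain x [set: Y * Z] = 1.
Proof.
rewrite /kchain /mkproduct /= /kproduct.
under eq_integral do rewrite kernel.intker_indicE// xsectionE preimage_setT prob_kernel.
by rewrite integral_cst// mul1e prob_kernel.
Qed.

HB.instance Definition _ :=
  Kernel_isProbability.Build _ _ _ _ _ kchain kchain_prob.
End kchain.

End kernels.

(* [mu] is the law on [lo, hi] with c.d.f. [F] and Lebesgue density [f] *)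
Definition has_cdf_density {R : realType} {I : segment R}
    (mu : {measure set (state I) -> \bar R}) (F f : R -> R) :=
  [/\ forall y, mu [set x | (state_val x <= y)%R] = (F y)%:E,
      measurable_fun [set: R] f,
      forall y, (0 <= f y)%R &
      forall B : set R, measurable B ->
        mu (@state_val _ I @^-1` B) =
        \int[lebesgue_measure]_(y in B `&` `[seg_lo I, seg_hi I]) (f y)%:E].

(* Families indexed by periods are indexed by [nat]; only the periods
   t = 1, ..., [horizon] matter. In [trans (theta, h) : Theta_t], [theta] is the
   state of period t - 1 and [h] the history of allocations up to period t - 1. *)
Record environment (R : realType) (dA : nat -> measure_display)
    (A : forall t, measurableType (dA t)) := Environment {
  horizon : nat;
  horizon_gt0 : (0 < horizon)%N;
  theta : nat -> segment R;
  init : probability (state (theta 1)) R;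
  init_cdf : R -> R;
  init_density : R -> R;
  initP : has_cdf_density init init_cdf init_density;
  trans : forall t, R.-pker (state (theta t.-1) * hist A t.-1) ~> state (theta t);
  trans_cdf : forall t, state (theta t.-1) * hist A t.-1 -> R -> R;
  trans_density : forall t, state (theta t.-1) * hist A t.-1 -> R -> R;
  transP : forall t (z : state (theta t.-1) * hist A t.-1),
    (1 < t <= horizon)%N ->
    has_cdf_density (trans t z) (trans_cdf z) (trans_density z);
  util : forall t, {mfun (state (theta t) * A t)%type >-> R};
  util_lipschitz : forall t (a : A t), (0 < t <= horizon)%N ->
    exists K : R, forall x y : state (theta t),
      (`|util t (x, a) - util t (y, a)| <= K * `|state_val x - state_val y|)%R;
  delta : R;
  delta_gt0 : (0 < delta)%R;
  delta_le1 : (delta <= 1)%R }.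

Section model.
Context {R : realType} {dA : nat -> measure_display}
  {A : forall t, measurableType (dA t)} (E : environment R A).

Definition Theta t : measurableType _ := state (theta E t).

Record mechanism := Mechanism {
  alloc : forall t, {mfun hist Theta t >-> A t};
  pay : forall t, {mfun hist Theta t >-> R};
  stop_pay : forall t, {mfun hist Theta t >-> R};
  rho : nat -> R;
  rho_horizon : rho (horizon E) = 0%R }.

(* In period t the report is a function of the current state and of the past
   reports and allocations. *)
Definition strategy := forall t,
  {mfun (Theta t * (hist Theta t.-1 * hist A t.-1))%type >-> Theta t}.

Definition state_of t (z : Theta t * (hist Theta t.-1 * hist A t.-1)) : Theta t :=
  z.1.

HB.instance Definition _ t :=
  isMeasurableFun.Build _ _ _ _ (@state_of t) measurable_fst.

Definition truthful : strategy := fun t => @state_of t.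

Section deviation.
Context t (th th' : Theta t).

Definition misreport (z : Theta t * (hist Theta t.-1 * hist A t.-1)) : Theta t :=
  if z.1 == th then th' else z.1.

Lemma measurable_misreport : measurable_fun [set: _] misreport.
Proof.
apply: measurable_fun_ifT => //=.
apply: (measurable_fun_bool true).
rewrite setTI (_ : _ @^-1` _ = fst @^-1` [set th]); last first.
  by apply/seteqP; split => z /= /eqP.
rewrite -[X in measurable X]setTI; apply: measurable_fst => //.
exists [set state_val th] => //.
rewrite setTI; apply/seteqP; split => x /= => [|->//].
by move=> h; exact: val_inj.
Qed.

HB.instance Definition _ :=
  isMeasurableFun.Build _ _ _ _ misreport measurable_misreport.

(* truthful in every period except t, where th' is reported at state th *)
Definition one_shot : strategy := eqtype.dfwith truthful misreport.

End deviation.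

Context (M : mechanism).

Fixpoint allocs t : hist Theta t -> hist A t :=
  match t with
  | 0 => fun=> tt
  | t'.+1 => fun r => (allocs r.1, alloc M t'.+1 r)
  end.

Lemma measurable_allocs t : measurable_fun [set: hist Theta t] (@allocs t).
Proof.
elim: t => [|t ih]; first exact: measurable_cst.
apply: measurable_fun_pair => /=; last exact: measurable_funPT.
exact: (measurableT_comp ih measurable_fst).
Qed.

(* Period-t report prescribed by [s] after the reports [r] (and the allocations
   to which they led), appended to [r]. *)
Definition report (s : strategy) t (r : hist Theta t) (th : Theta t.+1) :
    hist Theta t.+1 :=
  hrcons r (s t.+1 (th, (r, allocs r))).

Lemma measurable_report s d (X : measurableType d) t
    (r : X -> hist Theta t) (th : X -> Theta t.+1) :
  measurable_fun [set: X] r -> measurable_fun [set: X] th ->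
  measurable_fun [set: X] (fun x => report s (r x) (th x)).
Proof.
move=> mr mth; apply: measurable_fun_pair => //=.
apply: measurableT_comp => //.
apply: measurable_fun_pair => //=; apply: measurable_fun_pair => //=.
by apply: (measurableT_comp (@measurable_allocs t)).
Qed.

Context (s : strategy).

(* reports sent along the true states [p] when [s] is used from period 1 on *)
Fixpoint reports t : hist Theta t -> hist Theta t :=
  match t with
  | 0 => fun=> tt
  | t'.+1 => fun p => report s (reports p.1) p.2
  end.

(* the same when [s] is used from period n + 1 on, after the reports [r] *)
Fixpoint reports_from n (r : hist Theta n) k :
    hist Theta (k + n) -> hist Theta (k + n) :=
  match k with
  | 0 => fun=> r
  | k'.+1 => fun p => report s (reports_from r p.1) p.2
  end.

Lemma measurable_reports t : measurable_fun [set: hist Theta t] (@reports t).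
Proof.
elim: t => [|t ih]; first exact: measurable_cst.
apply: measurable_report; last exact: measurable_snd.
exact: (measurableT_comp ih measurable_fst).
Qed.

Lemma measurable_reports_from n k : measurable_fun
  [set: hist Theta n * hist Theta (k + n)] (fun z => reports_from z.1 z.2).
Proof.
elim: k => [|k ih]; first exact: measurable_fst.
apply: measurable_report; last exact: (measurableT_comp measurable_snd).
have m1 : measurable_fun [set: hist Theta n * hist Theta (k.+1 + n)]
    (fun z => (z.1, z.2.1)).
  apply: measurable_fun_pair => //=.
  exact: (measurableT_comp measurable_fst).
exact: (measurableT_comp ih m1).
Qed.

(* law of the state of period t + 2 given the states up to period t + 1 and the
   reports [rep] sent along them *)
Section step.
Context d (X : measurableType d) t
  (rep : {mfun (X * hist Theta t.+1)%type >-> hist Theta t.+1}).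

Definition step_arg (z : X * hist Theta t.+1) : Theta t.+1 * hist A t.+1 :=
  (z.2.2, allocs (rep z)).

Lemma measurable_step_arg : measurable_fun [set: _] step_arg.
Proof.
apply: measurable_fun_pair => /=.
  exact: (measurableT_comp measurable_snd).
exact: (measurableT_comp (@measurable_allocs t.+1)).
Qed.

HB.instance Definition _ :=
  isMeasurableFun.Build _ _ _ _ step_arg measurable_step_arg.

Definition step : R.-pker (X * hist Theta t.+1) ~> Theta t.+2 :=
  kpre (trans E t.+2) step_arg.

End step.

Definition init_kernel : R.-pker (unit * unit) ~> Theta 1 :=
  kprobability (measurable_cst (init E : pprobability (Theta 1) R)).

Definition snd_reports t (z : unit * hist Theta t) : hist Theta t :=
  reports z.2.

Lemma measurable_snd_reports t : measurable_fun [set: _] (@snd_reports t).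
Proof. exact: (measurableT_comp (@measurable_reports t)). Qed.

HB.instance Definition _ t :=
  isMeasurableFun.Build _ _ _ _ (@snd_reports t) (@measurable_snd_reports t).

(* law of the states of periods 1, ..., k + 1 *)
Fixpoint process k : R.-pker unit ~> hist Theta k.+1 :=
  match k with
  | 0 => kchain (kdirac (@measurable_id _ unit setT)) init_kernel
  | k'.+1 => kchain (process k') (step (@snd_reports k'.+1))
  end.

Definition snd_reports_from n k
    (z : (hist Theta n.+1 * hist Theta n) * hist Theta (k + n)) :=
  reports_from z.1.2 z.2.

Lemma measurable_snd_reports_from n k :
  measurable_fun [set: _] (@snd_reports_from n k).
Proof.
have m1 : measurable_fun
    [set: (hist Theta n.+1 * hist Theta n) * hist Theta (k + n)]
    (fun z => (z.1.2, z.2)).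
  apply: measurable_fun_pair => //=.
  exact: (measurableT_comp measurable_snd).
exact: (measurableT_comp (@measurable_reports_from n k) m1).
Qed.

HB.instance Definition _ n k := isMeasurableFun.Build _ _ _ _
  (@snd_reports_from n k) (@measurable_snd_reports_from n k).

Definition reports_from_mfun n k : {mfun
    ((hist Theta n.+1 * hist Theta n) * hist Theta (k + n))%type >->
    hist Theta (k + n)} := @snd_reports_from n k.

Definition past n :
    R.-pker (hist Theta n.+1 * hist Theta n) ~> hist Theta n.+1 :=
  kdirac (@measurable_fst _ _ (hist Theta n.+1) (hist Theta n)).

(* law of the states of periods 1, ..., n + 1 + k, given the states [x] of periods
   1, ..., n + 1 and the reports [r] of periods 1, ..., n, as a function of (x, r) *)
Fixpoint process_from n k :
    R.-pker (hist Theta n.+1 * hist Theta n) ~> hist Theta (k.+1 + n) :=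
  match k return
    R.-pker (hist Theta n.+1 * hist Theta n) ~> hist Theta (k.+1 + n) with
  | 0 => past n
  | k'.+1 => kchain (process_from n k') (@step _ (hist Theta n.+1 * hist Theta n)%type (k' + n)
                        (reports_from_mfun n k'.+1))
  end.

(* discounted payoff of periods 1, ..., t, the agent continuing in all of them,
   when the true states are [x] and the reports [r] *)
Fixpoint flow t : hist Theta t -> hist Theta t -> R :=
  match t with
  | 0 => fun _ _ => 0%R
  | t'.+1 => fun x r => (flow x.1 r.1 +
      delta E ^+ t'.+1 *
        (util E t'.+1 (x.2, alloc M t'.+1 r) + pay M t'.+1 r))%R
  end.

Definition payoff t (x r : hist Theta t.+1) : R :=
  (delta E ^+ t.+1 * (util E t.+1 (x.2, alloc M t.+1 r) + stop_pay M t.+1 r) +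
   flow x.1 r.1)%R.

(* J_{1,n+1}(n + 1 + k, ...): [x] are the true states of periods 1, ..., n + 1,
   [r] the reports of periods 1, ..., n, and the agent stops in period n + 1 + k *)
Definition interim n k (x : hist Theta n.+1) (r : hist Theta n) : \bar R :=
  (\int[process_from n k (x, r)]_p
     (payoff (p : hist Theta (k + n).+1) (reports_from (k := k.+1) r p))%:E)
  + (rho M (k + n).+1)%:E.

(* Bellman recursion, with k further periods after period n + 1 *)
Fixpoint value_rec k n (x : hist Theta n.+1) (r : hist Theta n) : \bar R :=
  match k with
  | 0 => interim 0 x r
  | k'.+1 => maxe (interim 0 x r)
      (\int[process_from n 1 (x, r)]_p
         value_rec k' (p : hist Theta n.+2)
           (reports_from (k := 1) r (p : hist Theta n.+2).1))
  end.

(* V_{n+1} *)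
Definition value n (x : hist Theta n.+1) (r : hist Theta n) : \bar R :=
  value_rec (horizon E - n.+1) x r.

End model.

Arguments truthful {R dA A E}.

(* Expectation, when [s] is used in period n + 1, of V_{n+2} for the strategy
   [s'] followed from period n + 2 on *)
Definition continuation (R : realType) (dA : nat -> measure_display)
    (A : forall t, measurableType (dA t)) (E : environment R A)
    (M : mechanism E) (s s' : strategy E) n
    (x : hist (Theta E) n.+1) (r : hist (Theta E) n) : \bar R :=
  \int[process_from M s n 1 (x, r)]_p
    value M s' (p : hist (Theta E) n.+2)
      (reports_from M s (k := 1) r (p : hist (Theta E) n.+2).1).

Definition integrability (R : realType) (dA : nat -> measure_display)
    (A : forall t, measurableType (dA t)) (E : environment R A)
    (M : mechanism E) :=
  forall (s : strategy E) n, (n < horizon E)%N ->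
    \int[process M s n tt]_p
      ereal_sup [set `|interim M s k p (reports M s p.1)|
                | k in [set k | (k + n < horizon E)%N]] < +oo.

Section sanity.
Context {R : realType} {dA : nat -> measure_display}
  {A : forall t, measurableType (dA t)} (E : environment R A)
  (M : mechanism E) (s : strategy E).

Lemma value_last n x r : n.+1 = horizon E ->
  @value _ _ _ E M s n x r = interim M s 0 x r.
Proof. by move=> nT; rewrite /value nT subnn. Qed.

Lemma value_bellman n x r : (n.+1 < horizon E)%N ->
  @value _ _ _ E M s n x r =
  maxe (interim M s 0 x r) (continuation M s s x r).
Proof. by move=> nT; rewrite /value -subnSK. Qed.

End sanity.

(* Main.v *)
Require Import Defs.
From HB Require Import structures.
From mathcomp Require Import all_boot all_order all_algebra.
From mathcomp Require Import all_classical all_reals all_analysis.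
From mathcomp Require Import measurable_realfun.
From mathcomp Require Import ring zify.

(** The proof compares, by backward induction on the period, the value of an
arbitrary strategy [s] with the value of truth-telling, at all true pasts [h]
and all reported pasts [r] at once. It rests on two facts.

First, the past is sunk ([interim0_pastD], [continuation_pastD]). The law of
the next state depends on the past only through the current state and the
allocations, hence through the reports, and the future payoffs depend on the
true states only from the current period on. So if two true pasts [h] and [h']
are followed by the same state and come with the same reports [r], all payoffs
and values at [h] and [h'] differ by the same real constant, the difference
[flow M h r - flow M h' r] of the payoffs already collected. Taking [h' := r]
turns any pair of pasts into a truthfully reported one, to which the one-shot
hypothesis applies; the constant is then added back to both sides
([no_gain_any_past]).

Second, at a given state [th] and given past reports [r], a strategy that is
truthful from the next period on yields the same payoffs as a one-shot
deviation: only the report sent at [th] matters ([report_one_shot]).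

Suppose then that truth-telling is optimal from the next period on. Replacing
[s] by truth-telling after the current period raises the continuation payoff
([le_continuation], monotonicity of the integral). What remains is a one-shot
deviation, which does not pay.

The integrals involved are those of extended-real functions which may fail to
be integrable, and the two properties used, monotonicity and commutation with
the addition of a constant, hold for all measurable functions thanks to the
convention [+oo - +oo = -oo]. *)

Set Implicit Arguments.
Unset Strict Implicit.
Unset Printing Implicit Defensive.
Import Order.TTheory GRing.Theory Num.Theory.
Import numFieldNormedType.Exports.

Local Open Scope classical_set_scope.
Local Open Scope ring_scope.
Local Open Scope ereal_scope.

(** * Integrals of measurable extended-real functions *)

Section integral.
Context d (T : measurableType d) (R : realType).
Implicit Types (f g : T -> \bar R).

(** The integral is the difference of those of the positive and the negative
part; the former increases with the function, the latter decreases, and with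
the convention [+oo - +oo = -oo] the extended subtraction is monotone even at
its indeterminate value. *)
Lemma le_integral_measurable (mu : {measure set T -> \bar R}) f g :
  measurable_fun [set: T] f -> measurable_fun [set: T] g ->
  (forall x, f x <= g x) -> \int[mu]_x f x <= \int[mu]_x g x.
Proof.
move=> mf mg fg; rewrite integralE [leRHS]integralE.
apply: leeB; apply: ge0_le_integral => //.
- exact: measurable_funepos.
- exact: measurable_funepos.
- by move=> x _; apply: (@funepos_le _ _ setT) => //; rewrite in_setT.
- exact: measurable_funeneg.
- exact: measurable_funeneg.
- by move=> x _; apply: (@funeneg_le _ _ setT) => //; rewrite in_setT.
Qed.

Lemma maxe0_leD (y : \bar R) (c : R) :
  maxe (y + c%:E) 0 <= maxe y 0 + `|c|%:E.
Proof.
rewrite ge_max; apply/andP; split; last by rewrite adde_ge0// le_max lexx orbT.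
by apply: leeD; [rewrite le_max lexx|rewrite lee_fin ler_norm].
Qed.

(** Shifting by [c] changes the positive and the negative part by at most the
absolute value of [c], so on a space of mass 1 it preserves the finiteness of
their integrals. Linearity settles the case of an integrable [f]; otherwise the
left-hand side is [-oo] or the right-hand side is [+oo]. *)
Lemma le_integralDcst (P : {measure set T -> \bar R}) f (c : R) :
  P [set: T] = 1 -> measurable_fun [set: T] f ->
  \int[P]_x f x + c%:E <= \int[P]_x (f x + c%:E).
Proof.
move=> P1 mf; pose g x := f x + c%:E.
have mg : measurable_fun [set: T] g by exact: emeasurable_funD.
have int_cst (r : R) : \int[P]_x r%:E = r%:E.
  by rewrite integral_cst// P1 mule1.
have icst : P.-integrable [set: T] (cst c%:E).
  by apply/integrableP; split => //=; rewrite int_cst ltry.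
have bounded h h' : measurable_fun [set: T] h -> measurable_fun [set: T] h' ->
    (forall x, 0 <= h x) -> (forall x, 0 <= h' x) ->
    (forall x, h' x <= h x + `|c|%:E) ->
    \int[P]_x h x < +oo -> \int[P]_x h' x < +oo.
  move=> mh mh' h0 h'0 hh' hoo.
  apply: (@le_lt_trans _ _ (\int[P]_x (h x + `|c|%:E))).
    by apply: ge0_le_integral => //; exact: emeasurable_funD.
  by rewrite ge0_integralD// int_cst lte_add_pinfty// ltry.
have [mfp mfn] := (measurable_funepos mf, measurable_funeneg mf).
have [mgp mgn] := (measurable_funepos mg, measurable_funeneg mg).
(* An infinite negative part makes the left-hand side [-oo]. *)
have [fn_oo|fn_fin] := leP +oo (\int[P]_x f^\- x).
  move: fn_oo; rewrite leye_eq => /eqP fn_oo.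
  by rewrite integralE fn_oo addeNy addNye leNye.
have gn_fin : \int[P]_x g^\- x < +oo.
  apply: bounded fn_fin => // x.
  by rewrite /g !funenegE fin_num_oppeD// -EFinN -normrN maxe0_leD.
(* The negative part of [g] being integrable, an infinite positive part makes
   the right-hand side [+oo]. *)
have [gp_oo|gp_fin] := leP +oo (\int[P]_x g^\+ x).
  move: gp_oo; rewrite leye_eq => /eqP gp_oo.
  rewrite [leRHS]integralE gp_oo addye ?leey//.
  by rewrite -ltNye lteNr.
have fp_fin : \int[P]_x f^\+ x < +oo.
  apply: bounded gp_fin => // x; rewrite !funeposE -normrN.
  by rewrite -{1}(@addeK _ c%:E (f x))// -EFinN maxe0_leD.
have intf : P.-integrable [set: T] f.
  apply/integrableP; split => //.
  under eq_integral do rewrite -/((abse \o f) _) fune_abse.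
  by rewrite ge0_integralD// lte_add_pinfty.
by rewrite (integralD _ intf icst)// int_cst.
Qed.

(** The inequality not covered by [le_integralDcst] is the same lemma for the
function [f + c] and the constant [- c]. *)
Lemma integralDcst (P : {measure set T -> \bar R}) f (c : R) :
  P [set: T] = 1 -> measurable_fun [set: T] f ->
  \int[P]_x (f x + c%:E) = \int[P]_x f x + c%:E.
Proof.
move=> P1 mf; apply/eqP; rewrite eq_le le_integralDcst// andbT.
have mfc : measurable_fun [set: T] (fun x => f x + c%:E).
  exact: emeasurable_funD.
have := le_integralDcst (- c) P1 mfc.
rewrite [leRHS](eq_integral f) => [|x _]; first by rewrite EFinN leeBlDr.
by rewrite EFinN addeK.
Qed.

End integral.

Lemma integral_pushforward_measurable d1 d2 (X : measurableType d1)
    (Y : measurableType d2) (R : realType) (phi : X -> Y)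
    (mu : {measure set X -> \bar R}) (f : Y -> \bar R) :
  measurable_fun [set: X] phi -> measurable_fun [set: Y] f ->
  \int[pushforward mu phi]_y f y = \int[mu]_x f (phi x).
Proof.
move=> mphi mf; rewrite [LHS]integralE [RHS]integralE.
congr (_ - _).
- rewrite (ge0_integral_pushforward mphi)//; last exact: measurable_funepos.
  by rewrite preimage_setT; apply: eq_integral => x _; rewrite /= !funeposE.
- rewrite (ge0_integral_pushforward mphi)//; last exact: measurable_funeneg.
  by rewrite preimage_setT; apply: eq_integral => x _; rewrite /= !funenegE.
Qed.

(** * Kernels *)

Section kernel.
Context d1 d2 d3 (X : measurableType d1) (Y : measurableType d2)
  (Z : measurableType d3) (R : realType).

Lemma kchain_dirac (f : X -> Y) (mf : measurable_fun [set: X] f)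
    (k : R.-pker (X * Y) ~> Z) x U : measurable U ->
  kchain (kdirac mf) k x U = pushforward (k (x, f x)) (pair (f x)) U.
Proof.
move=> mU; rewrite /kchain /mkproduct /= /kproduct integral_dirac//=.
- by rewrite diracT mul1e kernel.intker_indicE// xsectionE.
- exact: measurable_fun_pair2 (kernel.measurable_intker_indic k mU).
Qed.

(** This turns the expectation over the states up to the next period, the past
ones being known, into one over the next state alone. *)
Lemma integral_kchain_dirac (f : X -> Y) (mf : measurable_fun [set: X] f)
    (k : R.-pker (X * Y) ~> Z) x (g : Y * Z -> \bar R) :
  measurable_fun [set: Y * Z] g ->
  \int[kchain (kdirac mf) k x]_p g p = \int[k (x, f x)]_z g (f x, z).
Proof.
move=> mg.
rewrite (eq_measure_integral (pushforward (k (x, f x)) (pair (f x)))).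
  by rewrite integral_pushforward_measurable.
by move=> U mU _; exact: kchain_dirac.
Qed.

Lemma measurable_integral_kernel (k : R.-pker X ~> Y) (g : X * Y -> \bar R) :
  measurable_fun [set: X * Y] g ->
  measurable_fun [set: X] (fun x => \int[k x]_y g (x, y)).
Proof.
move=> mg.
rewrite (_ : (fun x => _) = (fun x => \int[k x]_y g^\+ (x, y)) \-
                            (fun x => \int[k x]_y g^\- (x, y))).
  apply: emeasurable_funB; apply: measurable_fun_integral_finite_kernel => //.
  - exact: measurable_funepos.
  - exact: measurable_funeneg.
apply/funext => x /=; rewrite integralE; congr (_ - _).
- by apply: eq_integral => y _; rewrite !funeposE.
- by apply: eq_integral => y _; rewrite !funenegE.
Qed.

End kernel.

(** * Payoffs and values as functions of true states and reports *)

Section model.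
Context {R : realType} {dA : nat -> measure_display}
  {A : forall t, measurableType (dA t)} (E : environment R A)
  (M : mechanism E).
Local Notation Theta := (Theta E).

Lemma measurable_pair_fst t : measurable_fun
  [set: hist Theta t.+1 * hist Theta t.+1] (fun z => (z.1.1, z.2.1)).
Proof. by apply: measurable_fun_pair; apply: measurableT_comp. Qed.

Lemma measurable_util_report t : measurable_fun
  [set: hist Theta t.+1 * hist Theta t.+1]
  (fun z => util E t.+1 (z.1.2, alloc M t.+1 z.2)).
Proof.
have m : measurable_fun [set: hist Theta t.+1 * hist Theta t.+1]
    (fun z => (z.1.2, alloc M t.+1 z.2)).
  by apply: measurable_fun_pair; apply: measurableT_comp.
exact: (measurableT_comp (measurable_funPT (util E t.+1)) m).
Qed.

Lemma measurable_flow t :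
  measurable_fun [set: hist Theta t * hist Theta t] (fun z => flow M z.1 z.2).
Proof.
elim: t => [|t ih]; first exact: measurable_cst.
apply: measurable_funD => /=.
  exact: (measurableT_comp ih (@measurable_pair_fst t)).
apply: measurable_funM => //; apply: measurable_funD.
- exact: measurable_util_report.
- exact: measurableT_comp.
Qed.

Lemma measurable_payoff t : measurable_fun
  [set: hist Theta t.+1 * hist Theta t.+1] (fun z => payoff M z.1 z.2).
Proof.
apply: measurable_funD => /=.
  apply: measurable_funM => //; apply: measurable_funD.
  - exact: measurable_util_report.
  - exact: measurableT_comp.
exact: (measurableT_comp (@measurable_flow t) (@measurable_pair_fst t)).
Qed.

(** Stopping at once involves no future state, so the interim payoff is a real
number, and the strategy enters only through the current report. *)
Lemma interim0E s n (x : hist Theta n.+1) (r : hist Theta n) :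
  interim M s 0 x r = (payoff M x (report M s r x.2) + rho M n.+1)%:E.
Proof.
rewrite /interim EFinD; congr (_ + _).
rewrite [LHS]integral_dirac// ?diracT ?mul1e//.
apply/measurable_EFinP.
have m : measurable_fun [set: hist Theta n.+1] (fun p => (p, report M s r p.2)).
  by apply: measurable_fun_pair => //; exact: measurable_report.
exact: (measurableT_comp (@measurable_payoff n) m).
Qed.

Lemma integral_process1 s n (x : hist Theta n.+1) (r : hist Theta n)
    (g : hist Theta n.+2 -> \bar R) : measurable_fun [set: hist Theta n.+2] g ->
  \int[process_from M s n 1 (x, r)]_p g p =
  \int[trans E n.+2 (x.2, allocs M (report M s r x.2))]_th g (hrcons x th).
Proof.
move=> mg; exact: (integral_kchain_dirac _ _ _ mg).
Qed.

Lemma measurable_value_rec s k n : measurable_fun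
  [set: hist Theta n.+1 * hist Theta n] (fun z => value_rec M s k z.1 z.2).
Proof.
have m0 m : measurable_fun [set: hist Theta m.+1 * hist Theta m]
    (fun z => interim M s 0 z.1 z.2).
  apply: (eq_measurable_fun (EFin \o (fun z => payoff M z.1
    (report M s z.2 z.1.2) + rho M m.+1)%R)) => [z _|].
    by rewrite interim0E.
  apply/measurable_EFinP; apply: measurable_funD => //.
  have mr : measurable_fun [set: hist Theta m.+1 * hist Theta m]
      (fun z => (z.1, report M s z.2 z.1.2)).
    apply: measurable_fun_pair => //; apply: measurable_report => //.
    exact: measurableT_comp.
  exact: (measurableT_comp (@measurable_payoff m) mr).
elim: k n => [//|k ih] n; apply: measurable_maxe => //.
have mr : measurable_fun
    [set: (hist Theta n.+1 * hist Theta n) * hist Theta n.+2]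
    (fun z => (z.2, report M s z.1.2 z.2.1.2)).
  apply: measurable_fun_pair => //; apply: measurable_report.
    exact: measurableT_comp.
  by apply: measurableT_comp => //; apply: measurableT_comp.
have := measurable_integral_kernel (process_from M s n 1)
  (measurableT_comp (ih n.+1) mr).
by apply: eq_measurable_fun => -[x r] _.
Qed.

(** * The past is sunk *)

Lemma payoff_pastD n (h h' r : hist Theta n) (th th' : Theta n.+1) :
  payoff M (hrcons h th) (hrcons r th') =
  (payoff M (hrcons h' th) (hrcons r th') + (flow M h r - flow M h' r))%R.
Proof. by rewrite /payoff /=; ring. Qed.

(** The current strategy [s] enters the expected next value only through the
report [r'] it prescribes now, and the true past only through the argument of
the next value. *)
Lemma integral_value_rec s s' k n (x : hist Theta n.+1) (r : hist Theta n)
    (r' := report M s r x.2) :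
  \int[process_from M s n 1 (x, r)]_p
    value_rec M s' k (p : hist Theta n.+2) (reports_from M s (k := 1) r p.1) =
  \int[trans E n.+2 (x.2, allocs M r')]_th value_rec M s' k (hrcons x th) r'.
Proof.
apply: integral_process1.
have mr : measurable_fun [set: hist Theta n.+2]
    (fun p => (p, report M s r p.1.2)).
  apply: measurable_fun_pair => //; apply: measurable_report => //.
  exact: measurableT_comp.
exact: (measurableT_comp (@measurable_value_rec s' k n.+1) mr).
Qed.

Lemma continuationE s s' n (x : hist Theta n.+1) (r : hist Theta n)
    (r' := report M s r x.2) :
  continuation M s s' x r =
  \int[trans E n.+2 (x.2, allocs M r')]_th value M s' (hrcons x th) r'.
Proof. exact: integral_value_rec. Qed.

Lemma measurable_value_rec_next s k n (x : hist Theta n.+1)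
    (r : hist Theta n.+1) :
  measurable_fun [set: Theta n.+2] (fun th => value_rec M s k (hrcons x th) r).
Proof.
have mx : measurable_fun [set: Theta n.+2] (fun th => (hrcons x th, r)).
  by apply: measurable_fun_pair => //; apply: measurable_fun_pair.
exact: (measurableT_comp (@measurable_value_rec s k n.+1) mx).
Qed.

Lemma interim0_pastD s n (h h' r : hist Theta n) (th : Theta n.+1) :
  interim M s 0 (hrcons h th) r =
  interim M s 0 (hrcons h' th) r + (flow M h r - flow M h' r)%:E.
Proof. by rewrite !interim0E -EFinD (payoff_pastD h h') addrAC. Qed.

(** The transition law only sees the current state and the reports, so the true
pasts [h] and [h'] lead to the same distribution of the next state; and the
payoff of the current period, collected on both sides, leaves the difference of
the flows unchanged. *)
Lemma value_rec_pastD s k n (h h' r : hist Theta n) (th : Theta n.+1) :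
  value_rec M s k (hrcons h th) r =
  value_rec M s k (hrcons h' th) r + (flow M h r - flow M h' r)%:E.
Proof.
elim: k n h h' r th => [|k ih] n h h' r th; first exact: interim0_pastD.
rewrite /= (interim0_pastD _ h h') adde_maxl; congr maxe.
rewrite !integral_value_rec -integralDcst//; last 2 first.
- exact: prob_kernel.
- exact: measurable_value_rec_next.
apply: eq_integral => th' _; rewrite (ih _ _ (hrcons h' th)).
by congr (_ + _%:E) => /=; ring.
Qed.

Lemma continuation_pastD s s' n (h h' r : hist Theta n) (th : Theta n.+1) :
  continuation M s s' (hrcons h th) r =
  continuation M s s' (hrcons h' th) r + (flow M h r - flow M h' r)%:E.
Proof.
rewrite !continuationE -integralDcst//; last 2 first.
- exact: prob_kernel.
- exact: measurable_value_rec_next.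
apply: eq_integral => th' _.
rewrite /value (value_rec_pastD _ _ _ (hrcons h' th)).
by congr (_ + _%:E) => /=; ring.
Qed.

(** * One-shot deviations *)

(** A strategy may depend on past reports and allocations whereas a one-shot
deviation does not; once these are given, misreporting [th] as the report that
[s] prescribes mimics [s]. *)
Lemma report_one_shot (s : strategy E) n (r : hist Theta n) (th : Theta n.+1) :
  report M (one_shot th (s n.+1 (th, (r, allocs M r)))) r th = report M s r th.
Proof. by rewrite /report /one_shot eqtype.dfwith_in /= /misreport eqxx. Qed.

Lemma interim0_one_shot (s : strategy E) n (h r : hist Theta n)
    (th : Theta n.+1) :
  interim M (one_shot th (s n.+1 (th, (r, allocs M r)))) 0 (hrcons h th) r =
  interim M s 0 (hrcons h th) r.
Proof. by rewrite !interim0E report_one_shot. Qed.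

Lemma continuation_one_shot (s s' : strategy E) n (h r : hist Theta n)
    (th : Theta n.+1) :
  continuation M (one_shot th (s n.+1 (th, (r, allocs M r)))) s'
    (hrcons h th) r = continuation M s s' (hrcons h th) r.
Proof. by rewrite !continuationE report_one_shot. Qed.

Lemma le_continuation s s1 s2 n (x : hist Theta n.+1) (r : hist Theta n) :
  (forall (y : hist Theta n.+2) (q : hist Theta n.+1),
    value M s1 y q <= value M s2 y q) ->
  continuation M s s1 x r <= continuation M s s2 x r.
Proof.
move=> le_val; rewrite (continuationE s s1) (continuationE s s2).
apply: le_integral_measurable; [exact: measurable_value_rec_next..|].
by move=> th; exact: le_val.
Qed.

(** The hypothesis speaks of the true past [r], reported truthfully; passing to
the true past [h] adds the same constant to the four payoffs. *)
Lemma no_gain_any_past (s s' : strategy E) n (h r : hist Theta n)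
    (th : Theta n.+1) :
  (forall th',
    maxe (interim M (one_shot th th') 0 (hrcons r th) r)
         (continuation M (one_shot th th') s' (hrcons r th) r) <=
    maxe (interim M s' 0 (hrcons r th) r)
         (continuation M s' s' (hrcons r th) r)) ->
  maxe (interim M s 0 (hrcons h th) r) (continuation M s s' (hrcons h th) r) <=
  maxe (interim M s' 0 (hrcons h th) r) (continuation M s' s' (hrcons h th) r).
Proof.
move=> /(_ (s n.+1 (th, (r, allocs M r)))).
rewrite interim0_one_shot continuation_one_shot => gain.
rewrite !(interim0_pastD _ h r) !(continuation_pastD _ _ h r) -!adde_maxl.
exact: leeD2r.
Qed.

Lemma no_gain_last_any_past (s s' : strategy E) n (h r : hist Theta n)
    (th : Theta n.+1) :
  (forall th', interim M (one_shot th th') 0 (hrcons r th) r <=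
    interim M s' 0 (hrcons r th) r) ->
  interim M s 0 (hrcons h th) r <= interim M s' 0 (hrcons h th) r.
Proof.
move=> /(_ (s n.+1 (th, (r, allocs M r)))); rewrite interim0_one_shot => gain.
by rewrite !(interim0_pastD _ h r); exact: leeD2r.
Qed.

End model.

(** * The one-shot deviation principle *)

Theorem proposition1 (R : realType) (dA : nat -> measure_display)
    (A : forall t, measurableType (dA t)) (E : environment R A)
    (M : mechanism E)
    (integrable : integrability M)
    (no_gain : forall n (h : hist (Theta E) n) (th th' : Theta E n.+1),
      (n.+1 < horizon E)%N ->
      maxe (interim M truthful 0 (hrcons h th) h)
           (continuation M truthful truthful (hrcons h th) h) >=
      maxe (interim M (one_shot th th') 0 (hrcons h th) h)
           (continuation M (one_shot th th') truthful (hrcons h th) h))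
    (no_gain_last : forall n (h : hist (Theta E) n) (th th' : Theta E n.+1),
      n.+1 = horizon E ->
      interim M truthful 0 (hrcons h th) h >=
      interim M (one_shot th th') 0 (hrcons h th) h) :
  forall (s : strategy E) n (h r : hist (Theta E) n) (th : Theta E n.+1),
    ((n.+1 < horizon E)%N ->
      maxe (interim M truthful 0 (hrcons h th) r)
           (continuation M truthful truthful (hrcons h th) r) >=
      maxe (interim M s 0 (hrcons h th) r)
           (continuation M s s (hrcons h th) r)) /\
    (n.+1 = horizon E ->
      interim M truthful 0 (hrcons h th) r >=
      interim M s 0 (hrcons h th) r).
Proof.
pose T := horizon E.
have le_value (s : strategy E) k n (x : hist (Theta E) n.+1)
    (r : hist (Theta E) n) :
    (n + k.+1)%N = T -> value M s x r <= value M truthful x r.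
  elim: k n x r => [|k ih] n [h th] r nT.
    have nT' : n.+1 = T by rewrite -nT addn1.
    rewrite (value_last M s _ _ nT') (value_last M truthful _ _ nT').
    apply: no_gain_last_any_past => th'.
    exact: no_gain_last.
  have nT' : (n.+1 < T)%N by rewrite -nT; lia.
  rewrite (value_bellman M s _ _ nT') (value_bellman M truthful _ _ nT').
  (* Compare both with [s] in this period and truth-telling afterwards. *)
  apply: le_trans (no_gain_any_past s h _); last first.
    by move=> th'; exact: no_gain.
  apply: le_max2; [exact: lexx | apply: le_continuation => y q].
  by apply: ih; rewrite addSnnS.
move=> s n h r th; split => nT.
- rewrite -(value_bellman M s _ _ nT) -(value_bellman M truthful _ _ nT).
  apply: (le_value _ (T - n.+1)%N); rewrite /T; lia.
- rewrite -(value_last M s _ _ nT) -(value_last M truthful _ _ nT).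
  by apply: (le_value _ 0%N); rewrite addn1.
Qed.
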